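(* Let $G$ be a connected graph with $n\ge 2$ vertices. Then $$n-2\ \ge\ QS_e(G)\ \ge\ 0$$ and $$\frac{n(n-1)}{2}\ \ge\ QS_{v,e}(G)\ \ge\ \frac n2.$$ The upper bounds are achieved if and only if $G$ is isomorphic to the star $S_n$, and the lower bounds are achieved if and only if $G$ is transmission regular.
   Context: All graphs are finite and simple. For a connected graph $G$ with $n$ vertices and $m$ edges, $d(u,v)$ is the graph distance and the transmission of a vertex $v$ is $\sigma(v)=\sum_{u\in V(G)}d(v,u)$. $G$ is transmission regular if $\sigma(u)=\sigma(v)$ for all vertices $u,v$. Put $\mathrm{irr}_{\mathrm{Tr}}(G)=\sum_{uv\in E(G)}|\sigma(u)-\sigma(v)|$, and $$QS_e(G)=\frac1m\,\mathrm{irr}_{\mathrm{Tr}}(G),\qquad QS_{v,e}(G)=\frac n2\left\{1+\frac1m\,\mathrm{irr}_{\mathrm{Tr}}(G)\right\}.$$ $S_n$ is the star with $n$ vertices, i.e. $K_{1,n-1}$. *)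

(* Defs.v *)
From mathcomp Require Import all_boot all_order all_algebra.

Set Implicit Arguments.
Unset Strict Implicit.
Unset Printing Implicit Defensive.

Import Order.TTheory GRing.Theory Num.Theory.

Record sgraph := SGraph {
  vertex :> finType;
  adj : rel vertex;
  adj_sym : symmetric adj;
  adj_irrefl : irreflexive adj }.

Definition connected_graph (G : sgraph) : Prop :=
  forall u v : G, connect (@adj G) u v.

Definition has_walk (G : sgraph) (u v : G) (k : nat) : bool :=
  [exists p : k.-tuple G, path (@adj G) u p && (last u p == v)].

(* The least length of a walk from u to v.  Lengths below #|G| suffice, and the
   junk value #|G| occurs only when u and v lie in different components; see
   has_walk_dist and dist_min. *)
Definition dist (G : sgraph) (u v : G) : nat :=
  find (has_walk u v) (iota 0 #|G|).

Lemma has_walkP (G : sgraph) (u v : G) (k : nat) :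
  reflect (exists p, [/\ size p = k, path (@adj G) u p & last u p = v])
          (has_walk u v k).
Proof.
apply: (iffP existsP) => [[p /andP[pp /eqP lp]]|[p [sp pp lp]]].
  by exists p; rewrite size_tuple.
have sp' : size p == k by apply/eqP.
by exists (Tuple sp'); rewrite /= pp lp eqxx.
Qed.

Lemma has_walk_dist (G : sgraph) (u v : G) :
  connect (@adj G) u v -> has_walk u v (dist u v).
Proof.
move=> /connectP[p0 pp0 lp0]; case: (shortenP pp0) lp0 => p pp up _ lp.
have sp : size p < #|G|.
  by have := max_card (mem (u :: p)); rewrite (card_uniqP up).
have h : has (has_walk u v) (iota 0 #|G|).
  apply/hasP; exists (size p); first by rewrite mem_iota.
  by apply/has_walkP; exists p.
have := nth_find 0 h; rewrite nth_iota //.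
by move: h; rewrite has_find size_iota.
Qed.

Lemma dist_min (G : sgraph) (u v : G) (k : nat) :
  has_walk u v k -> dist u v <= k.
Proof.
move=> hk; rewrite leqNgt; apply/negP => lk.
have kG : k < #|G|.
  by apply: leq_trans lk _; have := find_size (has_walk u v) (iota 0 #|G|); rewrite size_iota.
by have := before_find 0 lk; rewrite nth_iota // add0n hk.
Qed.

Definition transmission (G : sgraph) (v : G) : nat := \sum_(u : G) dist v u.

Definition transmission_regular (G : sgraph) : Prop :=
  forall u v : G, transmission u = transmission v.

(* Each undirected edge is represented by exactly one of its two orientations,
   the one increasing in the enumeration of G. *)
Definition edges (G : sgraph) : {set G * G} :=
  [set uv | adj uv.1 uv.2 && (enum_rank uv.1 < enum_rank uv.2)].

Definition irrTr (G : sgraph) : rat :=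
  (\sum_(uv in edges G)
     `|(transmission uv.1)%:R - (transmission uv.2)%:R : rat|)%R.

Definition QS_e (G : sgraph) : rat := (1 / #|edges G|%:R * irrTr G)%R.

Definition QS_ve (G : sgraph) : rat :=
  (#|G|%:R / 2 * (1 + 1 / #|edges G|%:R * irrTr G))%R.

Definition graph_iso (G H : sgraph) : Prop :=
  exists2 f : G -> H, bijective f & forall u v : G, adj (f u) (f v) = adj u v.

Definition star_adj (n : nat) : rel 'I_n :=
  fun i j => (i != j) && ((i == 0 :> nat) || (j == 0 :> nat)).

Lemma star_adj_sym (n : nat) : symmetric (@star_adj n).
Proof. by move=> i j; rewrite /star_adj eq_sym orbC. Qed.

Lemma star_adj_irrefl (n : nat) : irreflexive (@star_adj n).
Proof. by move=> i; rewrite /star_adj eqxx. Qed.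

Definition star (n : nat) : sgraph :=
  SGraph (@star_adj_sym n) (@star_adj_irrefl n).

(* Main.v *)
Require Import Defs.
From mathcomp Require Import all_boot all_order all_algebra.
From mathcomp Require Import perm.
From mathcomp Require Import lra.
Import Order.TTheory GRing.Theory Num.Theory.
Local Open Scope ring_scope.

(** Along an edge [uv] the distances to a third vertex differ by at most one,
    and the distances to [u] and to [v] contribute [0 + 1] and [1 + 0] to the
    two transmissions.  Hence [|sigma u - sigma v| <= n - 2], and averaging
    over the edges bounds [QS_e] by [n - 2].  The transmissions differ by
    exactly [n - 2] when the edge is pendant, that is, when one of its
    endpoints has no other neighbour: every walk leaving such an endpoint [u]
    must pass through [v], so the distance from [u] to any vertex other than
    [u] is one more than that from [v]; conversely, a second neighbour of [u] is at distance [1] from [u]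
    and at distance at least [1] from [v].  This edgewise bound with its
    equality case is [irr_edge_leif].

    The average therefore reaches [n - 2] exactly when every edge is pendant,
    and a connected graph in which this holds is a star
    ([all_pendant_starlike]).  The average is [0] exactly when the transmission
    is constant along every edge, which by connectedness makes it constant.
    Finally [QS_ve] is [n / 2 * (1 + QS_e)], an increasing affine function
    of [QS_e], so its bounds and their equality cases are those of [QS_e]. *)

(** * Distances along an edge *)

Section Distances.
Local Open Scope nat_scope.
Context {G : sgraph}.
Implicit Types u v w x y : G.

Lemma dist_refl u : dist u u = 0.
Proof.
by apply/eqP; rewrite -leqn0; apply/dist_min/has_walkP; exists [::].
Qed.

Lemma adj_neq {u v} : adj u v -> u != v.
Proof. by move=> auv; apply/eqP => uv; move: auv; rewrite uv adj_irrefl. Qed.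

Hypothesis Gconn : connected_graph G.

Lemma dist_eq0 u v : (dist u v == 0) = (u == v).
Proof.
apply/eqP/eqP => [d0|->]; last exact: dist_refl.
by have := has_walk_dist (Gconn u v); rewrite d0 => /has_walkP[p [/size0nil-> _]].
Qed.

Lemma dist_adj u v : adj u v -> dist u v = 1.
Proof.
move=> auv; apply/eqP; rewrite eqn_leq lt0n dist_eq0 adj_neq // andbT.
by apply/dist_min/has_walkP; exists [:: v]; rewrite /= auv.
Qed.

Lemma dist_step u v w : adj u v -> dist u w <= (dist v w).+1.
Proof.
move=> auv; have /has_walkP[p [sp pp lp]] := has_walk_dist (Gconn v w).
by apply/dist_min/has_walkP; exists (v :: p); rewrite /= sp auv.
Qed.

(** * Pendant edges *)

Definition only_neighbour u v : bool := [forall w, adj u w ==> (w == v)].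

Lemma only_neighbourP u v :
  reflect (forall w, adj u w -> w = v) (only_neighbour u v).
Proof.
by apply: (iffP forallP) => uv w; have := uv w; [move=> /implyP h /h/eqP|
  move=> h; apply/implyP => /h ->].
Qed.

(** A walk out of [u] starts with the step to [v], and the rest of it is a walk
    from [v]. *)
Lemma dist_only_neighbour u v w :
  only_neighbour u v -> w != u -> dist v w < dist u w.
Proof.
move=> /only_neighbourP uv wu.
have /has_walkP[[|x p] [<- /= + lp]] := has_walk_dist (Gconn u w).
  by move: wu; rewrite -lp eqxx.
case/andP => /uv eq_xv pp; subst x.
by rewrite ltnS; apply/dist_min/has_walkP; exists p.
Qed.

Lemma only_neighbour_dist u v : adj u v ->
  [forall (w | w != u), dist u w == (dist v w).+1] = only_neighbour u v.
Proof.
move=> auv; apply/forall_inP/idP => [dS|uv w wu]; last first.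
  by rewrite eqn_leq dist_step // dist_only_neighbour.
apply/only_neighbourP => w auw; have := dS w; rewrite eq_sym adj_neq //.
by move=> /(_ isT); rewrite dist_adj // eqSS eq_sym dist_eq0 => /eqP.
Qed.

(** The term at [u] is left out of both sums: it is [0] on the left and [1] on
    the right. *)
Lemma transmission_edge_leqif {u v} : adj u v ->
  transmission u + 2 <= transmission v + #|G| ?= iff only_neighbour u v.
Proof.
move=> auv; rewrite -only_neighbour_dist //.
have le_sum : \sum_(w | w != u) dist u w <= \sum_(w | w != u) (dist v w).+1
    ?= iff [forall (w | w != u), dist u w == (dist v w).+1].
  by apply: leqif_sum => w _; split; first exact: dist_step.
have eq_u : transmission u = \sum_(w | w != u) dist u w.
  by rewrite /transmission (bigD1 u) //= dist_refl.
have eq_v : transmission v + #|G| = \sum_(w | w != u) (dist v w).+1 + 2.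
  rewrite /transmission -sum1_card -big_split /= (bigD1 u) //=.
  rewrite dist_adj 1?adj_sym // addnC; congr (_ + _).
  by apply: eq_bigr => w _; rewrite addn1.
rewrite eq_u eq_v; case: le_sum => le_sum eq_sum.
by split; rewrite ?leq_add2r // eqn_add2r.
Qed.

Definition all_pendant : Prop :=
  forall u v, adj u v -> only_neighbour u v || only_neighbour v u.

(** * Stars *)

Definition starlike v : Prop :=
  forall x y, adj x y = (x != y) && ((x == v) || (y == v)).

Lemma starlike_pendant v : starlike v -> all_pendant.
Proof.
move=> st x y; rewrite st => /andP[xy /orP[/eqP xv|/eqP yv]]; apply/orP.
  right; apply/only_neighbourP => w.
  by rewrite st -xv (eq_sym y x) (negPf xy) /= => /andP[_ /eqP].
left; apply/only_neighbourP => w.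
by rewrite st -yv (negPf xy) /= => /andP[_ /eqP].
Qed.

Lemma connected_neq_adj u v : u != v -> exists w, adj u w.
Proof.
move=> uv; have /connectP[[|w p] /= pp lp] := Gconn u v.
  by rewrite lp eqxx in uv.
by exists w; case/andP: pp.
Qed.

Lemma connected_exists_edge : 1 < #|G| -> exists u v, adj u v.
Proof.
case/card_gt1P => u [v [_ _ /connected_neq_adj[w uw]]].
by exists u, w.
Qed.

Lemma connected_closed {P : pred G} {u} :
  P u -> (forall x y, adj x y -> P x -> P y) -> forall v, P v.
Proof.
move=> Pu stepP v; have /connectP[p pp ->] := Gconn u v.
by elim: p u Pu pp => //= x p IHp u Pu /andP[/stepP/(_ Pu)]; apply: IHp.
Qed.

(** Start from a pendant edge, with [u] attached to [v] only.  The neighbours of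
    [v] together with [v] are closed under adjacency: for a neighbour [x] of
    [v], either [x] has no other neighbour, or [v] has none, and then [x] is
    [u].  So [v] is adjacent to all other vertices, and an edge avoiding [v]
    could not be pendant. *)
Lemma all_pendant_starlike :
  1 < #|G| -> all_pendant -> exists v, starlike v.
Proof.
move=> /connected_exists_edge[a [b ab]] pend.
have [u [v [auv /only_neighbourP uv]]] : exists u v, adj u v /\ only_neighbour u v.
  by case/orP: (pend _ _ ab) => h; [exists a, b|exists b, a; rewrite adj_sym].
have dom : forall w, (w == v) || adj v w.
  apply: (connected_closed (u := v)) => [|x y axy]; first by rewrite eqxx.
  case/orP => [/eqP <-|avx]; first by rewrite axy orbT.
  case/orP: (pend _ _ avx) => /only_neighbourP only; last by rewrite (only y) ?eqxx.
  have eq_ux : u = x by apply: only; rewrite adj_sym.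
  by rewrite (uv y) ?eqxx // eq_ux.
exists v => x y; have [->|xy] /= := eqVneq x y; first exact: adj_irrefl.
have [eq_xv|xv] /= := eqVneq x v.
  by have := dom y; rewrite -eq_xv eq_sym (negPf xy).
have [->|yv] /= := eqVneq y v.
  by have := dom x; rewrite (negPf xv) adj_sym.
have adj_v w : w != v -> adj w v by move=> wv; have := dom w; rewrite (negPf wv) adj_sym.
apply/negP => /pend/orP[] /only_neighbourP only.
  by rewrite -(only v) ?eqxx // in yv; apply: adj_v.
by rewrite -(only v) ?eqxx // in xv; apply: adj_v.
Qed.

End Distances.

(** In the forward direction, the isomorphism is the enumeration of the
    vertices, preceded by the transposition that moves the centre to the first
    place. *)
Lemma starlike_iso {G : sgraph} : (0 < #|G|)%N ->
  (exists v : G, starlike v) <-> graph_iso G (star #|G|).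
Proof.
move=> G_gt0; pose o := Ordinal G_gt0.
have val0 (i : 'I_#|G|) : (i == 0 :> nat) = (i == o) by [].
split=> [[v st]|[f [g fK gK] fadj]].
  have rank_bij : bijective (enum_rank \o tperm v (enum_val o)).
    by apply: bij_comp (enum_rank_bij G) (injF_bij perm_inj).
  exists (enum_rank \o tperm v (enum_val o)) => // x y.
  have rank0 z : ((enum_rank \o tperm v (enum_val o)) z == o) = (z == v).
    by rewrite -(inj_eq (bij_inj rank_bij)) /= tpermL enum_valK.
  by rewrite /= /star_adj !val0 !rank0 (inj_eq (bij_inj rank_bij)) st.
exists (g o) => x y; rewrite -fadj /= /star_adj !val0.
by rewrite (can_eq fK) -!(can2_eq fK gK).
Qed.

(** * Averaging over the edges *)

Lemma norm_sub_leif {R : realDomainType} {a b c d : R} :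
  a + c <= b + d -> b + c <= a + d ->
  `|a - b| <= d - c ?= iff (a + c == b + d) || (b + c == a + d).
Proof.
move=> le_ab le_ba; split; first by rewrite ler_norml; apply/andP; split; lra.
apply/eqP/orP => [|[/eqP h|/eqP h]].
- by case: ger0P => s h; [left|right]; apply/eqP; lra.
- by case: ger0P => s; lra.
- by case: ger0P => s; lra.
Qed.

Section Averages.
Context {G : sgraph}.
Implicit Types u v : G.
Hypothesis Gconn : connected_graph G.

Lemma irr_edge_leif u v : adj u v ->
  `|(transmission u)%:R - (transmission v)%:R : rat| <= #|G|%:R - 2
    ?= iff only_neighbour u v || only_neighbour v u.
Proof.
move=> auv; have avu : adj v u by rewrite adj_sym.
have [le_uv eq_uv] := transmission_edge_leqif Gconn auv.
have [le_vu eq_vu] := transmission_edge_leqif Gconn avu.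
rewrite -eq_uv -eq_vu -!(eqr_nat rat) !natrD.
by apply: norm_sub_leif; rewrite -!natrD ler_nat.
Qed.

(** The set [edges G] keeps one orientation of each edge; symmetry makes the
    choice irrelevant. *)
Lemma edges_forall (P : rel G) : symmetric P ->
  [forall uv in edges G, P uv.1 uv.2] <-> (forall u v, adj u v -> P u v).
Proof.
move=> symP; split=> [/forall_inP edgeP u v auv|adjP]; last first.
  by apply/forall_inP => uv; rewrite inE => /andP[/adjP].
have oriented x y : adj x y -> (enum_rank x < enum_rank y)%N -> P x y.
  by move=> axy lt_xy; apply: (edgeP (x, y)); rewrite inE axy.
have [lt_uv|lt_vu|eq_uv] := ltngtP (enum_rank u) (enum_rank v).
- exact: oriented.
- by rewrite symP; apply: oriented; rewrite // adj_sym.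
- by move: (adj_neq auv); rewrite (enum_rank_inj (val_inj eq_uv)) eqxx.
Qed.

Lemma edges_gt0 : (1 < #|G|)%N -> (0 < #|edges G|)%N.
Proof.
move=> /(connected_exists_edge Gconn)[u [v auv]].
rewrite lt0n cards_eq0; apply/eqP => edges0.
have [no_edge _] := edges_forall (fun _ _ : G => false) (fun _ _ => erefl).
suff: false by []; apply: no_edge auv.
by apply/forall_inP => uv; rewrite edges0 inE.
Qed.

Lemma irrTr_leif : irrTr G <= #|edges G|%:R * (#|G|%:R - 2)
  ?= iff [forall uv in edges G,
            only_neighbour uv.1 uv.2 || only_neighbour uv.2 uv.1].
Proof.
rewrite mulr_natl -sumr_const; apply: leif_sum => uv.
by rewrite inE => /andP[auv _]; apply: irr_edge_leif.
Qed.

Lemma irrTr_ge0 : 0 <= irrTr G.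
Proof. by apply: sumr_ge0. Qed.

Lemma irrTr_eq0 : irrTr G = 0 <-> transmission_regular G.
Proof.
pose same : rel G := fun u v => transmission u == transmission v.
have irr0 : (irrTr G == 0) = [forall uv in edges G, same uv.1 uv.2].
  rewrite psumr_eq0 //.
  apply/allP/forall_inP => [h uv uvE|h uv _].
    have := h uv; rewrite mem_index_enum uvE /= => /(_ isT).
    by rewrite normr_eq0 subr_eq0 eqr_nat.
  by apply/implyP => /h; rewrite normr_eq0 subr_eq0 eqr_nat.
have adj_same := edges_forall same (fun u v => eq_sym _ _).
split=> [/eqP|reg]; last first.
  by apply/eqP; rewrite irr0; apply/adj_same => u v _; apply/eqP/reg.
rewrite irr0 => /adj_same same_adj u v; apply/eqP.
apply: (connected_closed Gconn (P := same u) (u := u)); first exact: eqxx.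
by move=> x y /same_adj/eqP xy /eqP ux; apply/eqP; rewrite ux.
Qed.

Hypothesis G_gt1 : (1 < #|G|)%N.

Lemma edges_pendantP :
  [forall uv in edges G,
     only_neighbour uv.1 uv.2 || only_neighbour uv.2 uv.1]
  <-> graph_iso G (star #|G|).
Proof.
have pend := edges_forall (fun u v => only_neighbour u v || only_neighbour v u)
  (fun u v => orbC _ _).
apply: (iff_trans pend); apply: iff_trans (starlike_iso (ltnW G_gt1)).
split; first exact: all_pendant_starlike.
by case=> v /starlike_pendant.
Qed.

Lemma QS_eE : #|edges G|%:R * QS_e G = irrTr G.
Proof. by rewrite mulrA mul1r mulfV ?mul1r // pnatr_eq0 -lt0n edges_gt0. Qed.

Lemma QS_e_leif : QS_e G <= #|G|%:R - 2
  ?= iff [forall uv in edges G,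
            only_neighbour uv.1 uv.2 || only_neighbour uv.2 uv.1].
Proof.
have m_gt0 : 0 < #|edges G|%:R :> rat by rewrite ltr0n edges_gt0.
have [le_irr eq_irr] := irrTr_leif.
split; first by rewrite -(ler_pM2l m_gt0) QS_eE.
by rewrite -eq_irr -QS_eE (inj_eq (mulfI (lt0r_neq0 m_gt0))).
Qed.

Lemma QS_e_ge0 : 0 <= QS_e G.
Proof. by rewrite mulr_ge0 ?divr_ge0 ?irrTr_ge0 ?ler0n. Qed.

Lemma QS_e_eq0 : QS_e G = 0 <-> transmission_regular G.
Proof.
apply: iff_trans irrTr_eq0; rewrite -QS_eE.
split=> [->|/eqP]; first by rewrite mulr0.
by rewrite mulf_eq0 pnatr_eq0 eqn0Ngt edges_gt0 //= => /eqP.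
Qed.

End Averages.

Theorem corollary2 (G : sgraph) (Gconn : connected_graph G) (n : nat)
    (Gn : #|G| = n) (n_ge2 : (2 <= n)%N) :
  [/\ n%:R - 2 >= QS_e G /\ QS_e G >= 0,
      (n%:R * (n%:R - 1)) / 2 >= QS_ve G /\ QS_ve G >= n%:R / 2,
      (QS_e G = n%:R - 2 <-> graph_iso G (star n)) /\
      (QS_ve G = (n%:R * (n%:R - 1)) / 2 <-> graph_iso G (star n))
    & (QS_e G = 0 <-> transmission_regular G) /\
      (QS_ve G = n%:R / 2 <-> transmission_regular G)].
Proof.
subst n.
have half_gt0 : 0 < #|G|%:R / 2 :> rat by rewrite divr_gt0 // ltr0n ltnW.
have half_inj := mulfI (lt0r_neq0 half_gt0).
have QS_veE : QS_ve G = #|G|%:R / 2 * (1 + QS_e G) by [].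
have maxE : #|G|%:R * (#|G|%:R - 1) / 2
    = #|G|%:R / 2 * (1 + (#|G|%:R - 2)) :> rat by lra.
have minE : #|G|%:R / 2 = #|G|%:R / 2 * (1 + 0) :> rat by rewrite addr0 mulr1.
have [le_max eq_max] := QS_e_leif Gconn n_ge2.
have ge_min : 0 <= QS_e G := QS_e_ge0.
have maxP : QS_e G = #|G|%:R - 2 <-> graph_iso G (star #|G|).
  by apply: iff_trans (edges_pendantP Gconn n_ge2); rewrite -eq_max; split=> /eqP.
have minP := QS_e_eq0 Gconn n_ge2.
have QS_ve_eq (a : rat) :
    QS_ve G = #|G|%:R / 2 * (1 + a) <-> QS_e G = a.
  by rewrite QS_veE; split=> [/half_inj/addrI|->].
split=> //.
- rewrite maxE QS_veE; split; first by rewrite ler_pM2l // lerD2l.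
  by rewrite [X in X <= _]minE ler_pM2l // lerD2l.
- by split=> //; rewrite maxE; apply: iff_trans (QS_ve_eq _) maxP.
- split=> //; rewrite [X in _ = X <-> _]minE; exact: iff_trans (QS_ve_eq _) minP.
Qed.
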